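(* Let $d\in\mathbb{N}$ and $\Omega=\{1,2,\ldots,d\}^{\mathbb{N}}$. For any Hölder potential $A:\Omega\to\mathbb{R}$ and each $\beta>0$, $$\mathfrak{P}_{2,\beta}(A)=\sup_{t\in\mathbb{R}}P_{\beta,A}(t),$$ where $$\mathfrak{P}_{2,\beta}(A)=\sup_{\rho\in\mathcal{P}(T)}\left\{\frac{\beta}{2}\rho(A)^2+h(\rho)-\log d\right\},\qquad P_{\beta,A}(t)=-\frac{\beta}{2}t^2+P(\beta tA)-\log d .$$
   Context: $T:\Omega\to\Omega$ is the shift $T(x_1,x_2,\ldots)=(x_2,x_3,\ldots)$; $\Omega$ carries the metric $d(x,y)=2^{-\min\{n:\,x_n\neq y_n\}}$, and ''Hölder'' refers to this metric. $\mathcal{P}(T)$ is the set of $T$-invariant Borel probabilities on $\Omega$; $h(\rho)$ is the Kolmogorov-Sinai entropy; $\rho(A)=\int A\,\mathrm{d}\rho$. The linear pressure is $P(B)=\sup_{\rho\in\mathcal{P}(T)}\{\rho(B)+h(\rho)\}$. *)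

(* Defs.v *)
From HB Require Import structures.
From mathcomp Require Import all_boot all_order all_algebra.
From mathcomp Require Import all_classical all_reals all_analysis.

Set Implicit Arguments.
Unset Strict Implicit.
Unset Printing Implicit Defensive.

Import Order.TTheory GRing.Theory Num.Theory.
Import numFieldNormedType.Exports.

Local Open Scope classical_set_scope.
Local Open Scope ring_scope.

(* {1, ..., d}^N.  The coordinate x_{n+1} of the mathematical notation is
   [x n], and the letter j+1 is [j : 'I_d].  The field [R] does not occur in
   the body: it is where the distance takes its values. *)
Definition Omega (R : realType) (d : nat) : Type := nat -> 'I_d.

Section metric.
Context (R : realType) (d : nat).
Implicit Types x y z : Omega R d.

HB.instance Definition _ := gen_eqMixin (Omega R d).
HB.instance Definition _ := gen_choiceMixin (Omega R d).

(* 2^(- min {n | x_n != y_n}); the exponent is shifted by one because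
   coordinates are numbered from 0 here and from 1 in the mathematics. *)
Definition Omega_dist x y : R :=
  if pselect (exists n, x n != y n) is left xy
  then 2 ^- (ex_minn xy).+1 else 0.

Lemma Omega_dist_ge0 x y : 0 <= Omega_dist x y.
Proof.
by rewrite /Omega_dist; case: pselect => // xy; rewrite invr_ge0 exprn_ge0.
Qed.

Lemma le_Omega_dist x y n : x n != y n -> 2 ^- n.+1 <= Omega_dist x y.
Proof.
move=> xyn; rewrite /Omega_dist; case: pselect => [xy|]; last by case; exists n.
case: ex_minnP => m _ /(_ n xyn) mn.
by rewrite lef_pV2 ?posrE ?exprn_gt0// ler_weXn2l ?ler1n.
Qed.

Lemma Omega_distxx x : Omega_dist x x = 0.
Proof.
rewrite /Omega_dist; case: pselect => // xx.
by case: (ex_minnP xx) => n; rewrite eqxx.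
Qed.

Lemma Omega_dist_positivity x y : Omega_dist x y = 0 -> x = y.
Proof.
move=> xy0; apply/funext => n; apply/eqP/negPn/negP => /le_Omega_dist.
by rewrite xy0 leNgt invr_gt0 exprn_gt0.
Qed.

Lemma Omega_dist_sym x y : Omega_dist x y = Omega_dist y x.
Proof.
rewrite /Omega_dist; case: pselect => [xy|nxy]; case: pselect => [yx|nyx] //.
- congr (2 ^- _.+1); case: ex_minnP => m xm mP; case: ex_minnP => p yp pP.
  by apply/eqP; rewrite eqn_leq mP 1?eq_sym// pP 1?eq_sym.
- by case: nyx; case: xy => n; rewrite eq_sym; exists n.
- by case: nxy; case: yx => n; rewrite eq_sym; exists n.
Qed.

Lemma Omega_dist_triangle y x z :
  Omega_dist x z <= Omega_dist x y + Omega_dist y z.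
Proof.
rewrite {1}/Omega_dist; case: pselect => [xz|_]; last first.
  by rewrite addr_ge0 ?Omega_dist_ge0.
case: ex_minnP => n xzn _; have [xyn|xyn] := eqVneq (x n) (y n).
  rewrite (le_trans (@le_Omega_dist y z n _)) -?xyn//.
  by rewrite lerDr Omega_dist_ge0.
by rewrite (le_trans (@le_Omega_dist x y n _))// lerDl Omega_dist_ge0.
Qed.

HB.instance Definition _ := @isMetric.Build R (Omega R d) Omega_dist
  Omega_distxx Omega_dist_positivity Omega_dist_sym Omega_dist_triangle.

End metric.

(* Measurable types are pointed, hence the restriction to d = k.+1 > 0. *)
HB.instance Definition _ (R : realType) (k : nat) :=
  isPointed.Build (Omega R k.+1) (fun=> ord0).

(* The Borel sigma-algebra of the metric topology. *)
HB.instance Definition _ (R : realType) (k : nat) :=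
  @isMeasurable.Build (sigma_display (@open (Omega R k.+1))) (Omega R k.+1)
    <<s @open (Omega R k.+1) >> (@sigma_algebra0 _ _ _)
    (@sigma_algebraC _ _) (@sigma_algebra_bigcup _ _ _).

Definition shift_map (R : realType) (d : nat) (x : Omega R d) : Omega R d :=
  fun n => x n.+1.

Definition hoelder_continuous (R : realType) (M : metricType R) (f : M -> R) : Prop :=
  exists C alpha : R, [/\ 0 <= C, 0 < alpha &
    forall x y, `|f x - f y| <= C * mdist x y `^ alpha].

Section entropy.
Context (disp : measure_display) (X : measurableType disp) (R : realType).
Variables (T : X -> X) (mu : probability X R).

Definition preserves_measure : Prop :=
  forall B : set X, measurable B -> mu (T @^-1` B) = mu B.

(* Cells may be empty; they contribute nothing to the entropy. *)
Definition measurable_partition (m : nat) (xi : 'I_m -> set X) : Prop :=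
  [/\ forall j, measurable (xi j), trivIset setT xi & \bigcup_j xi j = setT].

(* The cell of xi \/ T^-1 xi \/ ... \/ T^-(n-1) xi with itinerary w. *)
Definition join_cell (m : nat) (xi : 'I_m -> set X) (n : nat)
    (w : {ffun 'I_n -> 'I_m}) : set X :=
  [set x | forall i : 'I_n, xi (w i) (iter i T x)].

(* [ln 0 = 0], so null cells contribute 0. *)
Definition join_entropy (m : nat) (xi : 'I_m -> set X) (n : nat) : R :=
  - \sum_(w : {ffun 'I_n -> 'I_m})
      fine (mu (join_cell xi w)) * ln (fine (mu (join_cell xi w))).

(* The limit exists, by subadditivity, when [T] is measurable and preserves
   [mu]; otherwise [limn] may return an irrelevant default value. *)
Definition partition_entropy (m : nat) (xi : 'I_m -> set X) : R :=
  limn (fun n : nat => join_entropy xi n / n%:R).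

(* Kolmogorov-Sinai entropy. *)
Definition KS_entropy : \bar R :=
  ereal_sup [set h | exists (m : nat) (xi : 'I_m -> set X),
    measurable_partition xi /\ h = (partition_entropy xi)%:E].

End entropy.

Section pressure.
Context (R : realType) (k : nat).
Local Notation Om := (Omega R k.+1).
Local Notation T := (@shift_map R k.+1).
Implicit Types (A B : Om -> R) (beta t : R) (rho : probability Om R).

Definition invariant_probabilities : set (probability Om R) :=
  [set rho | preserves_measure T rho].

Definition mean_value rho A : R := (\int[rho]_x A x)%R.

Definition linear_pressure B : \bar R :=
  ereal_sup [set ((mean_value rho B)%:E + KS_entropy T rho)%E
            | rho in invariant_probabilities].

Definition quadratic_pressure beta A : \bar R :=
  ereal_sup [set ((beta / 2 * mean_value rho A ^+ 2)%:E + KS_entropy T rho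
                  - (ln k.+1%:R)%:E)%E
            | rho in invariant_probabilities].

Definition P_beta_A beta A t : \bar R :=
  ((- (beta / 2) * t ^+ 2)%:E
   + linear_pressure (fun x => (beta * t * A x)%R) - (ln k.+1%:R)%:E)%E.

End pressure.

(* Main.v *)
Require Import Defs.
From mathcomp Require Import all_boot all_order all_algebra.
From mathcomp Require Import all_classical all_reals all_analysis.
From mathcomp Require Import ring lra.

(** The statement is the Legendre duality of the square, integrated over the
    invariant probabilities.  Write m for the mean of A under rho.  Completing
    the square gives, for every real t,

      - (beta / 2) t^2 + beta t m <= (beta / 2) m^2,

    with equality at t = m, because the difference of the two sides is
    (beta / 2) (m - t)^2 and beta > 0.  Adding the entropy of rho and subtracting log d,
    the functional maximized by the quadratic pressure is therefore the maximum
    over t of the functional maximized by P_(beta, A)(t), and the theorem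
    merely exchanges two suprema, one over rho and one over t.  The
    entropy is carried along as an extended real attached to rho, which is why
    only finite terms are moved across the inequalities.

    The regularity of A enters through the identity
    rho (beta t A) = beta t rho(A), which holds as soon as A is integrable.  A
    Hoelder function on Omega is continuous, hence Borel, and it is bounded
    because Omega has diameter at most 1; so it is integrable for every
    probability. *)

Import Order.TTheory GRing.Theory Num.Theory.
Import numFieldNormedType.Exports.

Local Open Scope classical_set_scope.
Local Open Scope ring_scope.

Lemma hoelder_continuous_continuous (R : realType) (M : metricType R)
    (f : M -> R) : hoelder_continuous f -> continuous f.
Proof.
move=> [C [a [C0 a0 fC]]] x; apply/cvgrPdist_lt => e e0.
have C1 : 0 < C + 1 by lra.
have eC : 0 < e / (C + 1) by rewrite divr_gt0.
(* The radius at which the modulus of continuity (C + 1) r^a equals e; the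
   constant C + 1 is used since C may vanish. *)
pose r := (e / (C + 1)) `^ a^-1.
have r0 : 0 < r by rewrite powR_gt0.
apply/nbhs_ballP; exists r => //= y.
rewrite ballEmdist /= => xyr; apply: le_lt_trans (fC x y) _.
have : mdist x y `^ a < e / (C + 1).
  have -> : e / (C + 1) = r `^ a.
    by rewrite -powRrM mulVf ?gt_eqF// powRr1// ltW.
  by rewrite gt0_ltr_powR// nnegrE ?mdist_ge0// ltW.
rewrite ltr_pdivlMr// mulrC; apply: le_lt_trans.
by rewrite ler_wpM2r ?powR_ge0// lerDl.
Qed.

Lemma Omega_dist_le1 (R : realType) (d : nat) (x y : Omega R d) :
  Omega_dist x y <= 1.
Proof.
rewrite /Omega_dist; case: pselect => // xy.
by rewrite invf_le1 ?exprn_gt0// exprn_ege1// ler1n.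
Qed.

Section integrability.
Context (R : realType) (k : nat).
Implicit Types (f : Omega R k.+1 -> R) (rho : probability (Omega R k.+1) R).

Lemma continuous_Omega_measurable f :
  continuous f -> measurable_fun [set: Omega R k.+1] f.
Proof.
move=> /continuousP cf.
apply: (measurability _ (measurable_realfun.RGenOpens.measurableE R)).
move=> _ [_ [a [b ->] <-]]; rewrite setTI.
by apply: sub_sigma_algebra; exact/cf/interval_open.
Qed.

Lemma hoelder_Omega_bounded f :
  hoelder_continuous f -> [bounded f x | x in [set: Omega R k.+1]].
Proof.
move=> [C [a [C0 a0 fC]]].
(* Every point is at distance at most 1 from the base point, so f stays within
   C of its value there. *)
exists (`|f point| + C); split; rewrite ?num_real // => N fN x _ /=.
apply: le_trans (ltW fN); rewrite -lerBlDl.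
apply: le_trans (lerB_dist _ _) _; apply: le_trans (fC x point) _.
rewrite -[leRHS]mulr1 ler_wpM2l//.
have <- : 1 `^ a = 1 :> R by rewrite powR1.
by rewrite (ge0_ler_powR (ltW a0)) ?nnegrE ?mdist_ge0 //; exact: Omega_dist_le1.
Qed.

Lemma hoelder_Omega_integrable rho f :
  hoelder_continuous f -> rho.-integrable setT (EFin \o f).
Proof.
move=> hf; apply: measurable_bounded_integrable => //.
- exact: (le_lt_trans (probability_le1 _ _) (ltry _)).
- apply: continuous_Omega_measurable.
  exact: hoelder_continuous_continuous hf.
- exact: hoelder_Omega_bounded.
Qed.

Lemma mean_valueZ rho f (c : R) : hoelder_continuous f ->
  mean_value rho (fun x => c * f x) = c * mean_value rho f.
Proof.
by move=> hf; rewrite /mean_value RintegralZl//; exact: hoelder_Omega_integrable.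
Qed.

End integrability.

(* The alphabet has d = k.+1 letters, i.e. d ranges over the positive integers. *)
Theorem theorem3p5 (R : realType) (k : nat) (A : Omega R k.+1 -> R)
    (hA : hoelder_continuous A) (beta : R) (hbeta : 0 < beta) :
  quadratic_pressure beta A = ereal_sup [set P_beta_A beta A t | t in [set: R]].
Proof.
apply/eqP; rewrite eq_le; apply/andP; split; apply: ge_ereal_sup.
- move=> _ [rho inv_rho <-]; set m := mean_value rho A.
  (* The supremum over t is attained at t = m. *)
  apply: (@le_trans _ _ (P_beta_A beta A m)); last first.
    by apply: ereal_sup_ubound; exists m.
  rewrite /P_beta_A; apply: leeB => //.
  have -> : beta / 2 * m ^+ 2 = - (beta / 2) * m ^+ 2 + beta * m * m by field.
  rewrite EFinD -addeA leeD2l//.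
  by apply: ereal_sup_ubound; exists rho => //; rewrite mean_valueZ.
- move=> _ [t _ <-]; rewrite /P_beta_A leeBlDr// -leeBrDl//.
  apply: ge_ereal_sup => _ [rho inv_rho <-]; rewrite mean_valueZ//.
  rewrite leeBrDl// -leeBlDr//.
  set m := mean_value rho A.
  apply: (@le_trans _ _ ((beta / 2 * m ^+ 2)%:E
      + KS_entropy (@shift_map R k.+1) rho - (ln k.+1%:R)%:E)%E); last first.
    by apply: ereal_sup_ubound; exists rho.
  apply: leeB => //; rewrite addeA leeD2r// -EFinD lee_fin.
  rewrite -subr_ge0.
  have -> : beta / 2 * m ^+ 2 - (- (beta / 2) * t ^+ 2 + beta * t * m)
    = beta / 2 * (m - t) ^+ 2 by field.
  by rewrite mulr_ge0 ?sqr_ge0// divr_ge0// ltW.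
Qed.
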